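(* Let $n\ge 1$ be an integer and fix a real number $\kappa\in(0,n]$. Let $A\subset[0,1]^n$ be a Lebesgue measurable set that satisfies \[ \mathcal{H}^1(A\cap C)\le\kappa \quad\text{for all chains } C\subset[0,1]^n . \] Then $\mathcal{L}^n(A)\le\mathcal{L}^n(A_\kappa^{\ast})$, where \[ A_\kappa^{\ast}:=\left\{(x_1,\ldots,x_n)\in[0,1]^n : \frac{n-\kappa}{2}\le\sum_{i=1}^n x_i\le\frac{n+\kappa}{2}\right\}, \] and the set $A_\kappa^{\ast}$ is optimal, i.e. it itself satisfies $\mathcal{H}^1(A_\kappa^{\ast}\cap C)\le\kappa$ for all chains $C\subset[0,1]^n$. Moreover, $\mathcal{L}^n(A_\kappa^{\ast})=v_n(\kappa)$, where \[ v_n(\kappa):=1-\frac{2}{n!}\sum_{j=0}^{\lfloor\frac{n-\kappa}{2}\rfloor}(-1)^j\binom{n}{j}\left(\frac{n-\kappa}{2}-j\right)^n . \]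
   Context: For $\mathbf{x},\mathbf{y}\in\mathbb{R}^n$, write $\mathbf{x}\le\mathbf{y}$ if $x_i\le y_i$ for all $i\in\{1,\ldots,n\}$. A chain is a set $C\subset\mathbb{R}^n$ such that for every distinct $\mathbf{x},\mathbf{y}\in C$ either $\mathbf{x}\le\mathbf{y}$ or $\mathbf{y}\le\mathbf{x}$. $\mathcal{L}^n$ denotes $n$-dimensional Lebesgue measure. $\mathcal{H}^1$ denotes the $1$-dimensional Hausdorff outer measure on $\mathbb{R}^n$ with respect to the Euclidean metric, normalised so that a unit segment has measure $1$. $\lfloor x\rfloor$ is the largest integer less than or equal to $x$. *)

(* Defs.v *)
From HB Require Import structures.
From mathcomp Require Import all_boot all_order all_algebra.
From mathcomp Require Import all_classical all_reals all_analysis.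
Import Order.TTheory GRing.Theory Num.Theory.
Import numFieldNormedType.Exports.

Set Implicit Arguments.
Unset Strict Implicit.
Unset Printing Implicit Defensive.

Local Open Scope classical_set_scope.
Local Open Scope ring_scope.

(* Points of R^n are tuples: n.-tuple carries the product sigma-algebra, here
   that of the Borel sigma-algebra of measurableTypeR R. *)
Notation euclidean R n := (n.-tuple (measurableTypeR R)).

Section lebesgue_measure_rn.
Context (R : realType).

Section product.
Context (n : nat) (mu : {sigma_finite_measure set (euclidean R n) -> \bar R}).

Definition cons_point (p : measurableTypeR R * euclidean R n) :
  euclidean R n.+1 := [tuple of p.1 :: p.2].

Lemma measurable_cons_point : measurable_fun [set: _] cons_point.
Proof.
by apply: measurable_cons; [exact: measurable_fst|exact: measurable_snd].
Qed.

Definition lebesgue_cons : set (euclidean R n.+1) -> \bar R :=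
  pushforward (@lebesgue_measure R \x mu)%E cons_point.

Let measurable_preimage_cons A :
  measurable A -> measurable (cons_point @^-1` A).
Proof.
by move=> mA; rewrite -[X in measurable X]setTI; exact: measurable_cons_point.
Qed.

Let lebesgue_cons0 : lebesgue_cons set0 = 0%E.
Proof. by rewrite /lebesgue_cons /pushforward preimage_set0 measure0. Qed.

Let lebesgue_cons_ge0 A : (0 <= lebesgue_cons A)%E.
Proof.
rewrite /lebesgue_cons /pushforward.
exact: (measure_ge0 (@lebesgue_measure R \x mu)%E).
Qed.

Let lebesgue_cons_sigma_additive : semi_sigma_additive lebesgue_cons.
Proof.
move=> F mF tF mUF; rewrite /lebesgue_cons /pushforward preimage_bigcup.
apply: measure_semi_sigma_additive.
- by move=> k; exact: measurable_preimage_cons.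
- apply/trivIsetP => /= i j _ _ ij; rewrite -preimage_setI.
  by move/trivIsetP : tF => /(_ _ _ _ _ ij) ->//; rewrite preimage_set0.
- by rewrite -preimage_bigcup; exact: measurable_preimage_cons.
Qed.

HB.instance Definition _ := isMeasure.Build _ _ _ lebesgue_cons
  lebesgue_cons0 lebesgue_cons_ge0 lebesgue_cons_sigma_additive.

Let lebesgue_cons_sigma_finite : sigma_finite [set: _] lebesgue_cons.
Proof.
have /sigma_finiteP[F [TF ndF Foo]] := sigma_finiteT (@lebesgue_measure R).
have /sigma_finiteP[G [TG ndG Goo]] := sigma_finiteT mu.
pose behd (t : euclidean R n.+1) : euclidean R n := [tuple of behead t].
exists (fun k => (@tnth _ _ ^~ ord0) @^-1` F k `&` behd @^-1` G k).
  apply/esym; rewrite -subTset => t _.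
  have [i _ Fi] : (\bigcup_k F k) (tnth t ord0) by rewrite -TF.
  have [j _ Gj] : (\bigcup_k G k) (behd t) by rewrite -TG.
  exists (maxn i j) => //; split => /=.
  - by move: Fi; exact/subsetPset/ndF/leq_maxl.
  - by move: Gj; exact/subsetPset/ndG/leq_maxr.
move=> k; have [mF Fk] := Foo k; have [mG Gk] := Goo k; split.
  apply: measurableI.
  - by rewrite -[X in measurable X]setTI; exact: measurable_tnth.
  - by rewrite -[X in measurable X]setTI; exact: measurable_behead.
rewrite /lebesgue_cons /pushforward (_ : _ @^-1` _ = F k `*` G k).
  by rewrite product_measure1E// lte_mul_pinfty// ge0_fin_numE.
have behdK p : behd (cons_point p) = p.2 by exact: val_inj.
by apply/seteqP; split=> p; rewrite /= behdK.
Qed.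

HB.instance Definition _ := Measure_isSigmaFinite.Build _ _ _ lebesgue_cons
  lebesgue_cons_sigma_finite.

End product.

Fixpoint lebesgue_borel n :
    {sigma_finite_measure set (euclidean R n) -> \bar R} :=
  match n with
  | 0 => \d_([tuple] : euclidean R 0)
  | m.+1 => lebesgue_cons (lebesgue_borel m)
  end.

(* The library's completion of a measure: the Caratheodory restriction of the
   outer measure that it induces. *)
Definition lebesgue n (A : set (euclidean R n)) : \bar R :=
  @completed_measure_extension _ _ _ (lebesgue_borel n) A.

Definition lebesgue_measurable n (A : set (euclidean R n)) : Prop :=
  ((lebesgue_borel n)^*)%mu.-cara.-measurable A.

End lebesgue_measure_rn.

Section hausdorff.
Context (R : realType) (n : nat).
Implicit Types (x y : euclidean R n) (A C : set (euclidean R n)).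

Definition edistance x y : R :=
  Num.sqrt (\sum_(i < n) (tnth x i - tnth y i) ^+ 2).

(* The maximum with 0 makes the diameter of the empty set 0: its supremum
   is -oo. *)
Definition diameter A : \bar R :=
  maxe 0%E (ereal_sup [set (edistance p.1 p.2)%:E | p in A `*` A]).

Definition hausdorff1_pre (delta : R) A : \bar R :=
  ereal_inf [set (\sum_(0 <= k <oo) diameter (U k))%E |
    U in [set U : (set (euclidean R n))^nat |
      (forall k, (diameter (U k) <= delta%:E)%E) /\ A `<=` \bigcup_k U k]].

(* hausdorff1_pre is nonincreasing in delta, so that this supremum is the limit
   as delta tends to 0. *)
Definition hausdorff1 A : \bar R :=
  ereal_sup [set hausdorff1_pre delta A | delta in [set d | 0 < d]].

Definition coord_le x y : Prop := forall i : 'I_n, tnth x i <= tnth y i.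

Definition is_chain C : Prop :=
  forall x y, C x -> C y -> x <> y -> coord_le x y \/ coord_le y x.

Definition unit_cube : set (euclidean R n) :=
  [set x | forall i : 'I_n, 0 <= tnth x i <= 1].

Definition middle_slab (k : R) : set (euclidean R n) :=
  [set x | unit_cube x /\
    (n%:R - k) / 2 <= \sum_(i < n) tnth x i <= (n%:R + k) / 2].

End hausdorff.

Arguments unit_cube {R n}.
Arguments middle_slab {R} n k.

(* Num.truncn is the floor on nonnegative reals, as is (n - k) / 2 for k <= n. *)
Definition slab_volume (R : realType) (n : nat) (k : R) : R :=
  1 - 2 / n`!%:R *
    \sum_(0 <= j < (Num.truncn ((n%:R - k) / 2)).+1)
      (-1) ^+ j * 'C(n, j)%:R * ((n%:R - k) / 2 - j%:R) ^+ n.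

(* Main.v *)
(** The continuous analogue of the symmetric chain decomposition of a product of
chains (de Bruijn, van Ebbenhorst Tengbergen, Kruyswijk). The cube [[0,1]^(n+1)]
is swept out, with its Lebesgue measure, by monotone axis-parallel paths indexed
by [n] parameters, each path being symmetric about the middle level
[sum x_i = (n+1)/2] and parametrised by the level. In the inductive step a path
of length [l] times [[0,1]] is a rectangle, which is filled by the L-shaped
hooks that start at [(0, u)], run to [(l - u, u)] and then turn to
[(l - u, 1)]. On each such path H^1 dominates the l^1-length, so a set A as in
the theorem meets a path of length [l] in length at most [min(kappa, l)], which
is exactly the length met by the slab; integrating over the paths compares the
measures. On an arbitrary chain the level is an injection whose inverse is
1-Lipschitz, so the slab meets it in H^1-measure at most [kappa]. The two
parts of the cube outside the slab have the same measure because the paths are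
symmetric, and that measure is the Irwin-Hall formula. *)

Require Import Defs.
From mathcomp Require Import all_boot all_order all_algebra.
From mathcomp Require Import all_classical all_reals all_analysis.
From mathcomp Require Import measurable_realfun ring lra.
Import Order.TTheory GRing.Theory Num.Theory.
Import numFieldNormedType.Exports.

Local Open Scope classical_set_scope.
Local Open Scope ring_scope.

Set Implicit Arguments.
Unset Strict Implicit.
Unset Printing Implicit Defensive.

(** * Translations and reflections of the line *)

Section line.
Context {R : realType}.
Local Notation L := (measurableTypeR R).
Local Notation mu := (@lebesgue_measure R).
Implicit Types (c l : R) (A : set L).

Lemma measurable_translation c : measurable_fun [set: L] (+%R c : L -> L).
Proof.
by apply: (@measurable_funD _ _ R); [exact: measurable_cst|exact: measurable_id].
Qed.

Lemma measurable_reflection c : measurable_fun [set: L] ((fun x => c - x) : L -> L).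
Proof.
by apply: (@measurable_funB _ _ R); [exact: measurable_cst|exact: measurable_id].
Qed.

Lemma lebesgue_measure_translation c A :
  measurable A -> pushforward mu (+%R c : L -> L) A = mu A.
Proof.
move=> mA; apply/esym/lebesgue_measure_unique => //=; first exact: measurable_translation.
move=> _ _ [[a b]] _ <-; rewrite /= /pushforward.
rewrite (_ : _ @^-1` _ = `]a - c, b - c]%classic); last first.
  by apply/seteqP; split => x; rewrite /= !in_itv /=; lra.
rewrite !lebesgue_measure_itv/= !lte_fin ltrD2r -!EFinB.
by case: ifP => // _; congr EFin; ring.
Qed.

Lemma lebesgue_measure_reflection c A :
  measurable A -> pushforward mu ((fun x => c - x) : L -> L) A = mu A.
Proof.
move=> mA; apply/esym/lebesgue_measure_unique => //=; first exact: measurable_reflection.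
move=> _ _ [[a b]] _ <-; rewrite /= /pushforward.
rewrite (_ : _ @^-1` _ = `[c - b, c - a[%classic); last first.
  by apply/seteqP; split => x; rewrite /= !in_itv /=; lra.
rewrite !lebesgue_measure_itv/= !lte_fin ltrD2l ltrN2 -!EFinB.
by case: ifP => // _; congr EFin; ring.
Qed.

Lemma ge0_integral_reflection c (f : L -> \bar R) :
  measurable_fun [set: L] f -> (forall x, 0 <= f x)%E ->
  (\int[mu]_x f (c - x)%R = \int[mu]_x f x)%E.
Proof.
move=> mf f0.
rewrite -[LHS](@ge0_integral_pushforward _ _ _ _ R _ (measurable_reflection c) mu setT f)//.
apply: eq_measure_integral => [|? A mA _]; first exact: measurable_reflection.
exact: lebesgue_measure_reflection.
Qed.

End line.


Lemma measurable_set_bool d (T : measurableType d) (b : T -> bool) :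
  measurable_fun setT b -> measurable [set x | b x].
Proof. by move=> /(_ measurableT [set true] Logic.I); rewrite setTI. Qed.

(** * Filling a rectangle by L-shaped hooks *)

Section hook.
Context {R : realType}.
Local Notation L := (measurableTypeR R).
Local Notation mu := (@lebesgue_measure R).
Variables (l : R) (G : set (L * L)).
Hypothesis mG : measurable G.

(* The parts of the rectangle covered by the first and by the second arms of the
   hooks. *)
Let S1 : set (L * L) :=
  [set p | [&& 0 <= p.1, p.1 <= 1, 0 <= p.2 & p.2 < l - p.1]] `&` G.
Let S2 : set (L * L) :=
  [set p | [&& 0 <= p.1, p.1 <= 1, 0 <= p.2, p.2 <= l & l - p.1 <= p.2]] `&` G.

Let m1 : measurable_fun setT (fst : L * L -> R). Proof. exact: measurable_fst. Qed.
Let m2 : measurable_fun setT (snd : L * L -> R). Proof. exact: measurable_snd. Qed.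

Let mS1 : measurable S1.
Proof.
apply: measurableI => //; apply: measurable_set_bool.
by do !apply: measurable_and; (apply: measurable_fun_ler || apply: measurable_fun_ltr) => //;
  apply: measurable_funB.
Qed.

Let mS2 : measurable S2.
Proof.
apply: measurableI => //; apply: measurable_set_bool.
by do !apply: measurable_and; (apply: measurable_fun_ler || apply: measurable_fun_ltr) => //;
  apply: measurable_funB.
Qed.

Let xsection_hook_left (u : R) :
  mu [set s | 0 <= u <= 1 /\ 0 <= s <= l /\ G (u, s)] =
  (mu (xsection S1 u) + mu (xsection S2 u))%E.
Proof.
rewrite -measureU; [|exact: measurable_xsection|exact: measurable_xsection|]; last first.
  apply/seteqP; split => // s; rewrite !xsectionE => -[[/= /and4P[_ _ _ h1] _]].
  by move=> [/= /and5P[_ _ _ _]] /(lt_le_trans h1); rewrite ltxx.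
congr mu; apply/seteqP; split => s; rewrite !xsectionE /=.
  move=> [/andP[u0 u1] [/andP[s0 sl] gs]].
  have [h|h] := ltP s (l - u); [left|right]; split => //=; first exact/and4P.
  exact/and5P.
case=> -[/=]; first by move=> /and4P[u0 u1 s0 sl] gs; split; [lra|split => //; lra].
by move=> /and5P[u0 u1 s0 sl] _ gs; split; [lra|split => //; lra].
Qed.

Let xsection_hook_right (u : R) :
  mu [set r | [&& 0 <= u, u <= 1 & u <= l] /\ 0 <= r <= l + 1 - 2 * u /\
     G (u + Num.max 0 (r - (l - u)), Num.min r (l - u))] =
  (mu (xsection S1 u) + mu (ysection S2 (l - u)%R))%E.
Proof.
have mY : measurable (ysection S2 (l - u)) by exact: measurable_ysection.
(* On the second arm the parameter [r] has first coordinate [u + (r - (l - u)) = r + (2u - l)], so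
   translation by [2u - l] identifies this arm with a horizontal section of [S2]. *)
rewrite -[in RHS](lebesgue_measure_translation (u *+ 2 - l) mY) /pushforward.
have mYt : measurable ((+%R (u *+ 2 - l) : L -> L) @^-1` ysection S2 (l - u)).
  by rewrite -[X in measurable X]setTI; exact: (measurable_translation (u *+ 2 - l)).
rewrite -measureU//; [|exact: measurable_xsection|]; last first.
  apply/seteqP; split => // s; rewrite !xsectionE !ysectionE => -[[/= /and4P[_ _ _ h1] _]].
  by move=> [/= /and5P[_ _ _ _]]; rewrite mulr2n; lra.
congr mu; apply/seteqP; split => s; rewrite !xsectionE !ysectionE /=.
  move=> [/and3P[u0 u1 ul] [/andP[s0 sl]]].
  have [h|h] := ltP s (l - u); [left|right]; split => //=.
  - exact/and4P.
  - by move: b; rewrite max_l; [rewrite addr0|lra].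
  - apply/and5P; rewrite mulr2n; split; lra.
  - move: b; rewrite max_r; last by lra.
    by rewrite (_ : u + _ = u *+ 2 - l + s)//; rewrite mulr2n; ring.
case=> -[/=].
  move=> /and4P[u0 u1 s0 sl] gs; split; [apply/and3P; split; lra|split => //; first lra].
  by rewrite max_l ?min_l ?addr0//; lra.
rewrite mulr2n.
move=> /and5P[u0 u1 s0 sl] h gs; split; [apply/and3P; split; lra|split => //; first lra].
rewrite max_r ?min_r; [|lra..].
by rewrite (_ : u + _ = u + u - l + s)//; ring.
Qed.

(** Both sides measure the part of [G] in [[0, 1] x [0, l]]. The first arms are the vertical
    sections of [S1]; the second arm of the hook [u] is the horizontal section of [S2] at height
    [l - u]. So only the share of [S2] passes from vertical to horizontal sections, by Tonelli. For
    [u > l] both arms are empty. *)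
Lemma integral_hook :
  (\int[mu]_u mu [set s | (0 <= u <= 1)%R /\ (0 <= s <= l)%R /\ G (u, s)] =
   \int[mu]_u mu [set r | [&& 0 <= u, u <= 1 & u <= l]%R /\ (0 <= r <= l + 1 - 2 * u)%R /\
     G (u + Num.max 0 (r - (l - u)), Num.min r (l - u))%R])%E.
Proof.
under eq_integral do rewrite xsection_hook_left.
under [RHS]eq_integral do rewrite xsection_hook_right.
have mY : measurable_fun [set: L] (fun y => mu (ysection S2 y)) by exact: measurable_fun_ysection.
rewrite ge0_integralD//; [|exact: measurable_fun_xsection|exact: measurable_fun_xsection].
rewrite ge0_integralD//; [|exact: measurable_fun_xsection|]; last first.
  exact: (measurableT_comp mY (measurable_reflection l)).
congr (_ + _)%E.
(* The substitution of [l - u] by the height leaves the two iterated integrals of [S2], which agree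
   by uniqueness of the product measure. *)
rewrite (ge0_integral_reflection l mY)//.
have := @product_measure_unique _ _ L L R mu mu (mu \x^ mu)%E _ _ mS2.
by apply => A B mA mB; exact: product_measure2E.
Qed.

End hook.

Lemma measurable_preimage d1 d2 (T1 : measurableType d1) (T2 : measurableType d2)
    (f : T1 -> T2) (B : set T2) :
  measurable_fun setT f -> measurable B -> measurable (f @^-1` B).
Proof. by move=> mf mB; rewrite -[X in measurable X]setTI; exact: mf. Qed.

Lemma measurable_cst_set d (T : measurableType d) (P : Prop) :
  measurable [set _ : T | P].
Proof.
have [p|np] := pselect P.
  by rewrite (_ : [set _ | P] = setT)//; apply/seteqP; split.
by rewrite (_ : [set _ | P] = set0)//; apply/seteqP; split.
Qed.

(** * The decomposition of the cube into paths and its measure formula *)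

Section symmetric_chains.
Context {R : realType}.
Local Notation L := (measurableTypeR R).
Local Notation E n := (euclidean R n).
Local Notation mu := (@lebesgue_measure R).

Lemma measurable_preimage_cons d (T : measurableType d) n (f : T -> L)
    (g : T -> E n) (B : set (E n.+1)) :
  measurable_fun setT f -> measurable_fun setT g -> measurable B ->
  measurable [set x | B (cons_point (f x, g x))].
Proof.
move=> mf mg; apply: measurable_preimage.
apply: (measurableT_comp (@measurable_cons_point R n) (g := fun x => (f x, g x))).
exact: measurable_fun_pair.
Qed.

(* The paths of the decomposition are [chain_point t] on [[0, chain_length t]];
   the length -1 marks the parameters that index no path. *)
Fixpoint chain_length n : E n -> R :=
  match n with
  | 0 => fun=> 1
  | m.+1 => fun t =>
      let u := thead t in let l := @chain_length m [tuple of behead t] in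
      if [&& 0 <= u, u <= 1 & u <= l] then l + 1 - 2 * u else -1
  end.

(** [Num.min] and [Num.max] merge the two arms of a hook: up to [r = k] the point follows the path
    of [b] while the new coordinate rests at [u]; afterwards the path of [b] is halted, [u] short of
    its end, and the new coordinate moves. *)
Fixpoint chain_point n : E n -> R -> E n.+1 :=
  match n with
  | 0 => fun _ r => [tuple r]
  | m.+1 => fun t r =>
      let u := thead t in let b := [tuple of behead t] in
      let k := chain_length b - u in
      cons_point (u + Num.max 0 (r - k), @chain_point m b (Num.min r k))
  end.

Lemma behead_cons_point n p : [tuple of behead (@cons_point R n p)] = p.2.
Proof. exact: val_inj. Qed.

Lemma chain_point0 r : chain_point [tuple] r = cons_point (r, [tuple]).
Proof. by apply: val_inj. Qed.

Lemma chain_length_cons n u (t : E n) : chain_length (cons_point (u, t)) =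
  if [&& 0 <= u, u <= 1 & u <= chain_length t] then chain_length t + 1 - 2 * u else -1.
Proof. by rewrite [LHS]/= behead_cons_point. Qed.

Lemma chain_point_cons n u (t : E n) r : chain_point (cons_point (u, t)) r =
  cons_point (u + Num.max 0 (r - (chain_length t - u)),
              chain_point t (Num.min r (chain_length t - u))).
Proof. by rewrite [LHS]/= behead_cons_point. Qed.

Lemma measurable_thead n : measurable_fun [set: E n.+1] (@thead n R : E n.+1 -> R).
Proof. exact: (@measurable_tnth _ L n.+1 ord0). Qed.

Lemma measurable_chain_length n : measurable_fun [set: E n] (@chain_length n : E n -> R).
Proof.
elim: n => [|n IHn]; first exact: measurable_cst.
have mt := @measurable_thead n.
have ml : measurable_fun [set: E n.+1]
    (fun t : E n.+1 => chain_length [tuple of behead t]).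
  exact: (measurableT_comp IHn (@measurable_behead _ L n)).
apply: measurable_fun_ifT => //.
- by do !apply: measurable_and; apply: measurable_fun_ler.
- by apply: measurable_funB; [exact: measurable_funD|exact: measurable_funM].
Qed.

Lemma measurable_chain_point n :
  measurable_fun [set: E n * L] (fun p : E n * L => chain_point p.1 p.2).
Proof.
elim: n => [|n IHn].
  by apply: measurable_cons; [exact: measurable_snd|exact: measurable_cst].
have mt : measurable_fun [set: E n.+1 * L] (fun p : E n.+1 * L => thead p.1 : R).
  exact: (measurableT_comp (@measurable_thead n) measurable_fst).
have mb : measurable_fun [set: E n.+1 * L] (fun p : E n.+1 * L => [tuple of behead p.1]).
  exact: (measurableT_comp (@measurable_behead _ L n) measurable_fst).
have mk : measurable_fun [set: E n.+1 * L]
    (fun p : E n.+1 * L => chain_length [tuple of behead p.1] - thead p.1).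
  apply: measurable_funB => //.
  exact: (measurableT_comp (@measurable_chain_length n) mb).
have m2 : measurable_fun [set: E n.+1 * L] (fun p : E n.+1 * L => p.2 : R).
  exact: measurable_snd.
apply: (measurableT_comp (@measurable_cons_point _ _)).
apply: measurable_fun_pair.
  apply: (@measurable_funD _ _ R) => //; apply: measurable_maxr => //.
  exact: measurable_funB.
apply: (measurableT_comp (g := fun p : E n.+1 * L => ([tuple of behead p.1] : E n,
  Num.min p.2 (chain_length [tuple of behead p.1] - thead p.1) : L)) IHn).
by apply: measurable_fun_pair => //; exact: measurable_minr.
Qed.

Definition chain_section n (B : set (E n.+1)) (t : E n) : set L :=
  [set r | 0 <= r <= chain_length t /\ B (chain_point t r)].

Lemma measurable_chain_sections n (B : set (E n.+1)) : measurable B ->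
  measurable [set p : E n * L | chain_section B p.1 p.2].
Proof.
move=> mB; apply: measurableI; last exact: (measurable_preimage (@measurable_chain_point n)).
apply: measurable_set_bool; apply: measurable_and; apply: measurable_fun_ler => //.
exact: (measurableT_comp (@measurable_chain_length n) measurable_fst).
Qed.

Lemma measurable_chain_section n (B : set (E n.+1)) t : measurable B ->
  measurable (chain_section B t).
Proof.
by move=> /measurable_chain_sections /(measurable_xsection t); rewrite xsectionE.
Qed.

Lemma measurable_fun_chain_section n (B : set (E n.+1)) : measurable B ->
  measurable_fun setT (fun t => mu (chain_section B t)).
Proof.
move=> mB; rewrite (_ : (fun t => _) =
    mu \o xsection [set p : E n * L | chain_section B p.1 p.2]).
  by apply: measurable_fun_xsection; exact: measurable_chain_sections.
by apply/funext => t /=; rewrite xsectionE.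
Qed.

Lemma unit_cube_cons n y (x : E n) :
  unit_cube (cons_point (y, x)) <-> 0 <= y <= 1 /\ unit_cube x.
Proof.
split=> [h|[hy hx] i].
  split; first exact: (h ord0).
  by move=> i; have := h (lift ord0 i); rewrite tnthS.
by case: (unliftP ord0 i) => [j|] ->; rewrite ?tnthS.
Qed.

(** Induction on the dimension: slice by the first coordinate [y], decompose each slice along the
    lower-dimensional paths, and exchange the integrals over [y] and the path index [t]. For fixed
    [t] there remains the rectangle [[0, 1] x [0, chain_length t]], which [integral_hook]
    redistributes over the hooks. *)
Lemma lebesgue_chain_decomposition n (B : set (E n.+1)) : measurable B ->
  lebesgue_borel R n.+1 (B `&` unit_cube) =
  (\int[lebesgue_borel R n]_t mu (chain_section B t))%E.
Proof.
elim: n B => [|n IHn] B mB.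
  (* The index measure is a Dirac mass here: the only path is the unit interval. *)
  rewrite [RHS]integral_dirac ?diracT ?mul1e//; last exact: measurable_fun_chain_section.
  rewrite /= /lebesgue_cons /pushforward /product_measure1 /=.
  under eq_integral do rewrite /= diracE.
  rewrite (_ : (fun y => _) = (fun y => (\1_(chain_section B [tuple]) y)%:E)).
    by rewrite integral_indic// ?setIT//; exact: measurable_chain_section.
  apply/funext => y; rewrite indicE.
  congr ((nat_of_bool _)%:R%:E).
  rewrite xsectionE; apply/idP/idP => /set_mem /= [].
    by move=> By cy; apply/mem_set; split; first exact: (cy ord0).
  move=> cy By; apply/mem_set; split=> [|i]; last by rewrite (ord1 i).
  by rewrite -chain_point0.
have mBy (y : R) : measurable [set x : E n.+1 | 0 <= y <= 1 /\ B (cons_point (y, x))].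
  apply: measurableI; first exact: measurable_cst_set.
  by apply: (@measurable_preimage_cons _ _ _ (fun=> y) id) => //; exact: measurable_cst.
transitivity (\int[mu]_y lebesgue_borel R n.+1
    ([set x : E n.+1 | (0 <= y <= 1)%R /\ B (cons_point (y, x))] `&` unit_cube))%E.
  rewrite [LHS]/= /lebesgue_cons /pushforward /product_measure1.
  apply: eq_integral => y _; congr (lebesgue_borel R n.+1 _).
  rewrite xsectionE; apply/seteqP; split => x /=.
    by move=> [Bx /unit_cube_cons[]].
  by move=> [[y01 Bx] cx]; split=> //; exact/unit_cube_cons.
under eq_integral do rewrite IHn//.
(* The sections of [W] over [(y, t)] are the sets measured in the double integral; joint
   measurability of [W] allows Tonelli in [y] and [t]. *)
pose W : set ((L * E n) * L) :=
  [set p | 0 <= p.1.1 <= 1 /\ 0 <= p.2 <= chain_length p.1.2 /\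
           B (cons_point (p.1.1, chain_point p.1.2 p.2))].
have m11 : measurable_fun setT (fun p : (L * E n) * L => p.1.1 : R).
  exact: (measurableT_comp measurable_fst measurable_fst).
have m12 : measurable_fun setT (fun p : (L * E n) * L => p.1.2).
  exact: (measurableT_comp measurable_snd measurable_fst).
have m2 : measurable_fun setT (fun p : (L * E n) * L => p.2 : R).
  exact: measurable_snd.
have mW : measurable W.
  apply: measurableI; last apply: measurableI.
  - by apply: measurable_set_bool; apply: measurable_and; exact: measurable_fun_ler.
  - apply: measurable_set_bool; apply: measurable_and; apply: measurable_fun_ler => //.
    exact: (measurableT_comp (@measurable_chain_length n)).
  - apply: measurable_preimage_cons => //.
    apply: (measurableT_comp (@measurable_chain_point n)
      (g := fun p : (L * E n) * L => (p.1.2, p.2))).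
    exact: measurable_fun_pair.
rewrite [RHS](@ge0_integral_pushforward _ _ _ _ R _ (@measurable_cons_point R n)
  (mu \x lebesgue_borel R n)%E setT (fun t => mu (chain_section B t)))//; last first.
  exact: measurable_fun_chain_section.
rewrite preimage_setT fubini_tonelli2//; last first.
  exact: (measurableT_comp (measurable_fun_chain_section mB) (@measurable_cons_point R n)).
transitivity (\int[lebesgue_borel R n]_t \int[mu]_y mu (xsection W (y, t)))%E.
  transitivity (\int[mu]_y \int[lebesgue_borel R n]_t mu (xsection W (y, t)))%E; last first.
    apply: (@fubini_tonelli _ _ L (E n) R mu (lebesgue_borel R n)
      (fun p => mu (xsection W p))) => //.
    exact: measurable_fun_xsection.
  apply: eq_integral => y _; apply: eq_integral => t _; congr mu.
  rewrite xsectionE; apply/seteqP; split => r /=; [by move=> [? []]|by move=> [? []]].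
apply: eq_integral => t _; rewrite /fubini_G.
pose G : set (L * L) := [set p | B (cons_point (p.1, chain_point t p.2))].
have mG : measurable G.
  apply: (measurable_preimage_cons _ _ mB); first exact: measurable_fst.
  apply: (measurableT_comp (@measurable_chain_point n) (g := fun p : L * L => (t, p.2))).
  by apply: measurable_fun_pair => //; exact: measurable_snd.
transitivity (\int[mu]_u mu [set s | (0 <= u <= 1)%R /\ (0 <= s <= chain_length t)%R /\ G (u, s)])%E.
  by apply: eq_integral => y _; rewrite xsectionE.
rewrite integral_hook//; apply: eq_integral => u _; congr mu.
rewrite [RHS](_ : _ = [set r | 0 <= r <= chain_length (cons_point (u, t)) /\
    B (chain_point (cons_point (u, t)) r)])//.
under [RHS]eq_set do rewrite chain_length_cons chain_point_cons.
apply/seteqP; split => r; rewrite /= /G /=; first by move=> [-> []].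
(* An index of no path has length -1, so its section is empty. *)
by case: ifPn => // _ [] /andP[r0] /(le_trans r0); rewrite ler0N1.
Qed.
End symmetric_chains.

(** * Level, monotonicity and metric behaviour of the paths *)

Section chain_geometry.
Context {R : realType}.
Local Notation L := (measurableTypeR R).
Local Notation E n := (euclidean R n).
Local Notation mu := (@lebesgue_measure R).

Lemma tnth_cons_point0 n (y : R) (x : E n) : tnth (cons_point (y, x)) ord0 = y.
Proof. by []. Qed.

Lemma tnth_cons_pointS n (y : R) (x : E n) i :
  tnth (cons_point (y, x)) (lift ord0 i) = tnth x i.
Proof. by rewrite tnthS. Qed.

Lemma sum_cons_point n (y : R) (x : E n) :
  \sum_i tnth (cons_point (y, x)) i = y + \sum_i tnth x i.
Proof. by rewrite big_ord_recl; under eq_bigr do rewrite tnth_cons_pointS. Qed.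

Lemma cons_pointP n (t : E n.+1) : exists u s, t = cons_point (u, s).
Proof. by case/tupleP: t => u s; exists u, s; exact: val_inj. Qed.

Lemma chain_length_ge0 n u (t : E n) : 0 <= chain_length (cons_point (u, t)) ->
  [/\ 0 <= u, u <= 1, u <= chain_length t &
      chain_length (cons_point (u, t)) = chain_length t + 1 - 2 * u].
Proof. by rewrite chain_length_cons; case: ifPn => [/and3P[]|] //; rewrite ler0N1. Qed.

Lemma maxB0 (r k : R) : Num.max 0 (r - k) = r - Num.min r k.
Proof. by have [h|h] := leP r k; [rewrite max_l; lra|rewrite max_r; lra]. Qed.

(** The level grows at unit speed because [max 0 (r - k) + min r k = r]. The constant puts the ends
    of the path at the levels [(n + 1 - l) / 2] and [(n + 1 + l) / 2], where [l] is its length: this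
    is the symmetry about the middle level. *)
Lemma sum_chain_point n (t : E n) r : 0 <= chain_length t ->
  \sum_i tnth (chain_point t r) i = (n.+1%:R - chain_length t) / 2 + r.
Proof.
elim: n t r => [|n IHn] t r; first by rewrite big_ord1 /= subrr mul0r add0r.
have [u [s ->]] := cons_pointP t; move=> /chain_length_ge0[u0 u1 us ->].
rewrite chain_point_cons sum_cons_point IHn; last exact: le_trans us.
rewrite -[n.+2%:R]natr1 maxB0; lra.
Qed.

Lemma chain_point_monotone n (t : E n) r s :
  r <= s -> coord_le (chain_point t r) (chain_point t s).
Proof.
elim: n t r s => [|n IHn] t r s rs; first by move=> i; rewrite (ord1 i).
have [u [b ->]] := cons_pointP t; rewrite !chain_point_cons => i.
case: (unliftP ord0 i) => [j|] ->.
  by rewrite !tnth_cons_pointS; apply: IHn; rewrite le_min2.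
by rewrite !tnth_cons_point0 lerD2l le_max2// lerD2r.
Qed.

Lemma chain_point_unit_cube n (t : E n) r :
  0 <= r <= chain_length t -> unit_cube (chain_point t r).
Proof.
elim: n t r => [|n IHn] t r; first by move=> r01 i; rewrite (ord1 i).
have [u [b ->]] := cons_pointP t; rewrite !chain_point_cons => /andP[r0 rl].
have [u0 u1 ub le] := chain_length_ge0 (le_trans r0 rl).
move: rl; rewrite le => rl.
have k0 : 0 <= chain_length b - u by rewrite subr_ge0.
apply/unit_cube_cons; split; last apply: IHn.
  by rewrite addr_ge0 ?le_max ?lexx//= -lerBrDl ge_max; apply/andP; split; lra.
by rewrite le_min r0 k0 /= ge_min; apply/orP; right; lra.
Qed.

Lemma chain_point_is_chain n (t : E n) (A : set R) :
  is_chain [set chain_point t r | r in A].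
Proof.
move=> _ _ [r _ <-] [s _ <-] _.
by have [rs|/ltW sr] := leP r s; [left|right]; exact: chain_point_monotone.
Qed.

Lemma edistanceC n (x y : E n) : edistance x y = edistance y x.
Proof. by rewrite /edistance; congr Num.sqrt; apply: eq_bigr => i _; rewrite -sqrrN opprB. Qed.

Lemma coord_le_edistance n (x y : E n) i : `|tnth x i - tnth y i| <= edistance x y.
Proof.
rewrite -sqrtr_sqr /edistance ler_wsqrtr// (bigD1 i)//= lerDl.
by apply: sumr_ge0 => j _; exact: sqr_ge0.
Qed.

Lemma edistance_cons_point n (a b : R) (x y : E n) :
  edistance x y <= edistance (cons_point (a, x)) (cons_point (b, y)).
Proof.
rewrite /edistance ler_wsqrtr// [leRHS]big_ord_recl.
by under [in leRHS]eq_bigr do rewrite !tnth_cons_pointS; rewrite lerDr sqr_ge0.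
Qed.

(* The excluded set consists of a short interval just before each corner. *)
Lemma chain_point_expanding n (t : E n) (d : R) : 0 <= chain_length t -> 0 < d ->
  exists N : set L, [/\ measurable N, (mu N <= (n%:R * n%:R * d)%:E)%E &
    forall r s, ~ N r -> ~ N s -> edistance (chain_point t r) (chain_point t s) <= d ->
      `|r - s| <= edistance (chain_point t r) (chain_point t s)].
Proof.
move=> + d0; elim: n t => [|n IHn] t.
  exists set0; rewrite measure0 !mul0r; split => // r s _ _ _.
  exact: (coord_le_edistance (chain_point t r) (chain_point t s) ord0).
have [u [b ->]] := cons_pointP t; move=> /chain_length_ge0[u0 u1 ub _].
have [N [mN N_le exp]] := IHn b (le_trans u0 ub).
set k := chain_length b - u.
(* If [r < k <= s] and the two points are within [d], then [k - r <= (n + 1) * d]; removing this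
   interval leaves no close pair on both sides of the corner [k]. *)
pose N' : set L := [set` `[k - n.+1%:R * d, k[%R].
have mN' : measurable N' by exact: measurable_itv.
exists (N `|` N'); split.
- exact: measurableU.
- apply: le_trans (measureU2 _ mN mN') _.
  rewrite [X in (_ + X)%E]lebesgue_measure_itv/= lte_fin.
  rewrite ifT; last by rewrite ltrBlDr ltrDl mulr_gt0.
  rewrite -EFinB; apply: le_trans (leeD2r _ N_le) _; rewrite -EFinD lee_fin -natr1.
  have := ler0n R n; nra.
move=> r s /not_orP[Nr N'r] /not_orP[Ns N's].
wlog rs : r s Nr N'r Ns N's / r <= s.
  have [rs H|/ltW sr H h] := leP r s; first exact: H.
  by rewrite distrC edistanceC; apply: H => //; rewrite edistanceC.
rewrite !chain_point_cons -/k.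
set x := cons_point _; set y := cons_point _ => xy.
(* Before the corner the induction hypothesis applies; after it only the first coordinate moves. *)
have [sk|ks] := ltP s k.
  have rk : r < k by exact: le_lt_trans sk.
  have le1 : edistance (chain_point b r) (chain_point b s) <= edistance x y.
    by rewrite /x /y (min_l (ltW rk)) (min_l (ltW sk)) edistance_cons_point.
  apply: le_trans (le1); apply: exp => //; exact: le_trans le1 xy.
have [kr|rk] := leP k r.
  have := coord_le_edistance x y ord0; rewrite /x /y !tnth_cons_point0.
  rewrite !max_r ?subr_ge0// (_ : u + _ - _ = r - s)//; ring.
exfalso; have {}N'r : r < k - n.+1%:R * d.
  by rewrite ltNge; apply/negP => h; apply: N'r; rewrite /N' /= in_itv /= h rk.
have : k - r <= n.+1%:R * d; last by lra.
have b0 : 0 <= chain_length b by exact: le_trans ub.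
(* The gap is a difference of levels, hence a sum of [n + 1] coordinate differences, each at most
   [d]. *)
rewrite (_ : k - r = \sum_i (tnth (chain_point b k) i - tnth (chain_point b r) i)); last first.
  by rewrite sumrB !sum_chain_point//; ring.
rewrite mulr_natl -[n.+1 in leRHS]card_ord -sumr_const; apply: ler_sum => i _.
apply: le_trans (ler_norm _) _; rewrite distrC.
apply: le_trans (coord_le_edistance _ _ _) _; apply: le_trans xy.
by rewrite /x /y (min_l (ltW rk)) (min_r ks) edistance_cons_point.
Qed.
End chain_geometry.

(** * Hausdorff measure on the paths and on arbitrary chains *)

Section hausdorff_of_chains.
Context {R : realType}.
Local Notation L := (measurableTypeR R).
Local Notation E n := (euclidean R n).
Local Notation mu := (@lebesgue_measure R).

Lemma diameter_ge0 n (U : set (E n)) : (0 <= diameter U)%E.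
Proof. by rewrite /diameter le_max lexx. Qed.

Lemma le_diameter n (U : set (E n)) x y : U x -> U y ->
  ((edistance x y)%:E <= diameter U)%E.
Proof.
move=> Ux Uy; rewrite /diameter le_max; apply/orP; right.
by apply: ereal_sup_ubound; exists (x, y).
Qed.

Lemma diameter_le n (U : set (E n)) (d : R) : 0 <= d ->
  (forall x y, U x -> U y -> edistance x y <= d) -> (diameter U <= d%:E)%E.
Proof.
move=> d0 Ud; rewrite /diameter ge_max lee_fin d0 /=; apply: ge_ereal_sup.
by move=> _ [[x y] [Ux Uy] <-]; rewrite lee_fin; exact: Ud.
Qed.

Lemma diameter_set0 n : diameter (@set0 (E n)) = 0%E.
Proof. by apply/eqP; rewrite eq_le diameter_ge0 diameter_le. Qed.

Lemma le_hausdorff1 n (A B : set (E n)) :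
  A `<=` B -> (hausdorff1 A <= hausdorff1 B)%E.
Proof.
move=> AB; apply: ge_ereal_sup => _ [d d0 <-].
apply: (@le_trans _ _ (hausdorff1_pre d B)); last by apply: ereal_sup_ubound; exists d.
apply: ereal_inf_le_tmp => _ [U [Ud BU] <-]; exists U => //; split=> //.
exact: subset_trans BU.
Qed.

(** Turns a set of a cover into a measurable set of parameters at no cost: the interval from [inf V]
    of length [d], or the whole line if [d] is infinite. *)
Lemma small_set_cover (V : set R) (d : \bar R) : (0 <= d)%E ->
  (forall r s, V r -> V s -> (`|r - s|%:E <= d)%E) ->
  exists I : set L, [/\ measurable I, V `<=` I & (mu I <= d)%E].
Proof.
case: d => [d d0 Vd|_ _|]; last by [].
- have [->|/set0P[r0 Vr0]] := eqVneq V set0; first by exists set0; rewrite measure0; split.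
  have lbV r : V r -> lbound V (r - d).
    move=> Vr s Vs; have := Vd _ _ Vr Vs; rewrite lee_fin => /ler_normlW; lra.
  exists [set` `[inf V, inf V + d]]; split.
  + exact: measurable_itv.
  + move=> r Vr; rewrite /= in_itv /=; apply/andP; split.
      by apply: ge_inf => //; exists (r0 - d); exact: lbV.
    by rewrite -lerBlDr; apply: lb_le_inf; [exists r0|exact: lbV].
  + rewrite lebesgue_measure_itv/= lte_fin; case: ifPn => // _.
    by rewrite -EFinB lee_fin; lra.
- by exists setT; split => //; rewrite leey.
Qed.

(** A cover by sets of diameter at most [d] is pulled back to the parameters. Off the set [N] of
    [chain_point_expanding], parameters are no farther apart than their points, so each pulled-back
    set lies in one of measure at most the diameter; [N] itself costs at most [e]. *)
Lemma chain_section_le_hausdorff1 n (t : E n) (B : set (E n.+1)) :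
  0 <= chain_length t -> measurable B ->
  (mu (chain_section B t) <=
   hausdorff1 (B `&` [set chain_point t r | r in [set` `[0, chain_length t]%R]]))%E.
Proof.
move=> l0 mB; set C := [set _ | _ in _]; have mS := measurable_chain_section t mB.
(* This [d] brings the measure bound [n * n * d] for [N] below [e]; the [+ 1] keeps the denominator
   positive for [n = 0]. *)
apply/lee_addgt0Pr => e e0; pose d := e / (n%:R * n%:R + 1).
have nn0 : 0 < n%:R * n%:R + 1 :> R by have := ler0n R n; nra.
have d0 : 0 < d by exact: divr_gt0.
have de : n%:R * n%:R * d <= e.
  have : d * (n%:R * n%:R + 1) = e by rewrite divfK// gt_eqF.
  lra.
have [N [mN N_le exp]] := chain_point_expanding l0 d0.
apply: (@le_trans _ _ (hausdorff1_pre d (B `&` C) + e%:E)%E); last first.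
  by apply: leeD2r; apply: ereal_sup_ubound; exists d.
rewrite -leeBlDr//; apply: le_ereal_inf_tmp => _ [U [Ud BU] <-].
rewrite leeBlDr//.
have /choice[I HI] : forall k, exists I : set L,
    [/\ measurable I, [set r | ~ N r /\ U k (chain_point t r)] `<=` I &
        (mu I <= diameter (U k))%E].
  move=> k; apply: small_set_cover; first exact: diameter_ge0.
  move=> r s [Nr Ur] [Ns Us]; apply: le_trans (le_diameter Ur Us).
  rewrite lee_fin; apply: exp => //; rewrite -lee_fin.
  exact: le_trans (le_diameter Ur Us) (Ud k).
have mSN : measurable (chain_section B t `\` N) by exact: measurableD.
have SU : chain_section B t `<=` (chain_section B t `\` N) `|` N.
  by move=> r Sr; have [Nr|Nr] := pselect (N r); [right|left].
apply: (@le_trans _ _ (mu ((chain_section B t `\` N) `|` N))).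
  by apply: le_measure; rewrite ?inE//; exact: measurableU.
apply: le_trans (measureU2 _ mSN mN) _; apply: leeD; last first.
  by apply: le_trans N_le _; rewrite lee_fin.
apply: (@le_trans _ _ (\sum_(0 <= k <oo) mu (I k))%E).
  apply: measure_sigma_subadditive => //; first by move=> k; have [] := HI k.
  move=> r [[rl Br] Nr].
  have [|k _ Uk] := BU (chain_point t r).
    by split=> //; exists r => //=; rewrite in_itv.
  by exists k => //; have [_ + _] := HI k; apply.
by apply: lee_nneseries => k _ //; have [] := HI k.
Qed.

(** The increments are nonnegative, so the sum of their squares is at most the square of their
    sum. *)
Lemma edistance_le_sum n (x y : E n) : coord_le x y ->
  edistance x y <= \sum_i tnth y i - \sum_i tnth x i.
Proof.
move=> xy; rewrite -sumrB; set S := \sum_i _.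
have yx0 i : 0 <= tnth y i - tnth x i by rewrite subr_ge0.
have S0 : 0 <= S by exact: sumr_ge0.
rewrite -[leRHS]ger0_norm// -sqrtr_sqr /edistance ler_wsqrtr//.
rewrite expr2 {1}/S mulr_suml; apply: ler_sum => i _.
rewrite -sqrrN opprB expr2 ler_wpM2l//.
by rewrite /S (bigD1 i)//= lerDl; exact: sumr_ge0.
Qed.

(** The levels of the slab fill an interval of length [k]. It is cut into [m] pieces of width
    [w = k / m <= d]; by [edistance_le_sum] the part of the chain over each piece has diameter at
    most [w], and [m * w = k]. *)
Lemma hausdorff1_chain_slab n (C : set (E n)) (k : R) : 0 < k -> is_chain C ->
  (hausdorff1 (middle_slab n k `&` C) <= k%:E)%E.
Proof.
move=> k0 chC; apply: ge_ereal_sup => _ [d d0 <-].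
pose m := (Num.truncn (k / d)).+1; pose w := k / m%:R.
have m0 : 0 < m%:R :> R by rewrite ltr0n.
have w0 : 0 < w by exact: divr_gt0.
have wd : w <= d.
  rewrite ler_pdivrMr// mulrC -ler_pdivrMr//; apply: ltW.
  by rewrite /m; apply: truncnS_gt.
pose s (x : E n) := \sum_i tnth x i.
pose U i : set (E n) := if (i < m)%N then
  [set x | C x /\ (n%:R - k) / 2 + i%:R * w <= s x <= (n%:R - k) / 2 + i.+1%:R * w]
  else set0.
have dU i : (diameter (U i) <= w%:E)%E.
  apply: diameter_le => [|x y]; first exact: ltW.
  rewrite /U; case: ifPn => // _ [Cx /andP[x1 x2]] [Cy /andP[y1 y2]].
  have [->|/eqP xy] := eqVneq x y.
    by apply: le_trans (edistance_le_sum _) _ => //; rewrite subrr ltW.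
  move: x1 x2 y1 y2; rewrite -[i.+1%:R]natr1 => x1 x2 y1 y2.
  have [xly|ylx] := chC _ _ Cx Cy xy; last rewrite edistanceC.
    apply: le_trans (edistance_le_sum xly) _; rewrite -/(s x) -/(s y); lra.
  apply: le_trans (edistance_le_sum ylx) _; rewrite -/(s x) -/(s y); lra.
apply: ge_ereal_inf; exists (\sum_(0 <= i <oo) diameter (U i))%E.
  exists U => //; split=> [i|x [[_ /andP[x1 x2]] Cx]].
    by apply: le_trans (dU i) _; rewrite lee_fin.
  pose j := Num.truncn ((s x - (n%:R - k) / 2) / w).
  have q0 : 0 <= (s x - (n%:R - k) / 2) / w.
    by rewrite divr_ge0 ?subr_ge0// ltW.
  have := truncn_itv q0; rewrite -/j ler_pdivlMr// ltr_pdivrMr// => /andP[j1 j2].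
  have wm : m%:R * w = k by rewrite /w mulrC divfK// gt_eqF.
  have [jm|mj] := ltnP j m.
    by exists j => //; rewrite /U jm; split=> //; rewrite -/(s x); lra.
  (* Only the top level [(n + k) / 2] gets here; it belongs to the last piece, which is closed. *)
  exists m.-1 => //; rewrite /U prednK// leqnn; split=> //.
  have : m%:R <= j%:R :> R by rewrite ler_nat.
  have : m.-1%:R + 1 = m%:R :> R by rewrite natr1 prednK.
  rewrite -/(s x) in x1 x2 *; nra.
rewrite (@nneseries_split _ _ 0 m)//; last by move=> i _; exact: diameter_ge0.
rewrite add0n (@eseries0 _ _ m)//; last first.
  by move=> i mi _; rewrite /U ltnNge mi /= diameter_set0.
rewrite adde0; apply: (@le_trans _ _ (\sum_(0 <= i < m) w%:E)%E).
  by apply: lee_sum => i _; exact: dU.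
rewrite sumEFin lee_fin sumr_const_nat subn0 -mulr_natr /w divfK// gt_eqF//.
Qed.
End hausdorff_of_chains.

(** * Comparison with the slab for Borel sets, and inner approximation *)

Section borel_comparison.
Context {R : realType}.
Local Notation L := (measurableTypeR R).
Local Notation E n := (euclidean R n).
Local Notation mu := (@lebesgue_measure R).

Lemma measurable_sum_tnth n :
  measurable_fun [set: E n] (fun x : E n => \sum_(i < n) (tnth x i : R)).
Proof. by apply: measurable_sum => i; exact: (@measurable_tnth _ L n i). Qed.

Lemma measurable_sum_between n (a b : R) :
  measurable [set x : E n | a <= \sum_(i < n) tnth x i <= b].
Proof.
apply: measurable_set_bool; apply: measurable_and; apply: measurable_fun_ler => //;
  exact: measurable_sum_tnth.
Qed.

Lemma measurable_unit_cube n : measurable (@unit_cube R n).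
Proof.
elim: n => [|n IHn].
  by rewrite (_ : unit_cube = setT)//; apply/seteqP; split => // x _ [].
have mb : measurable_fun [set: E n.+1] (fun x : E n.+1 => [tuple of behead x] : E n).
  exact: (@measurable_behead _ L n).
have mth : measurable_fun [set: E n.+1] (fun x : E n.+1 => thead x : R).
  exact: (@measurable_thead R n).
rewrite (_ : unit_cube = [set x : E n.+1 | 0 <= thead x <= 1] `&`
    (fun x : E n.+1 => [tuple of behead x] : E n) @^-1` unit_cube).
  apply: measurableI; last exact: measurable_preimage mb IHn.
  by apply: measurable_set_bool; apply: measurable_and; exact: measurable_fun_ler.
apply/seteqP; split => x; have [u [s ->]] := cons_pointP x.
  by rewrite /= behead_cons_point => /unit_cube_cons.
by rewrite /= behead_cons_point => ?; exact/unit_cube_cons.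
Qed.

Lemma lebesgue_borel_unit_cube n : lebesgue_borel R n unit_cube = 1%E.
Proof.
elim: n => [|n IHn].
  by rewrite /= diracE mem_set// => -[].
rewrite /= /lebesgue_cons /pushforward.
rewrite (_ : _ @^-1` _ = [set` `[0, 1]%R] `*` unit_cube); last first.
  apply/seteqP; split => -[y x] /=; first by move=> /unit_cube_cons[]; rewrite in_itv.
  by rewrite in_itv => ?; exact/unit_cube_cons.
rewrite product_measure1E//; last exact: measurable_unit_cube.
rewrite IHn mule1 [LHS](@lebesgue_measure_itv R `[0, 1])/=.
by rewrite lte_fin ltr01 -EFinB subr0.
Qed.

Lemma middle_slabE n (k : R) : middle_slab n k =
  [set x | (n%:R - k) / 2 <= \sum_(i < n) tnth x i <= (n%:R + k) / 2] `&` unit_cube.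
Proof. by rewrite setIC. Qed.

Lemma measurable_middle_slab n (k : R) : measurable (middle_slab n k).
Proof.
rewrite middle_slabE; apply: measurableI; last exact: measurable_unit_cube.
exact: measurable_sum_between.
Qed.

(** The comparison holds path by path: a path of length at most [k] lies entirely in the slab, and a
    longer one meets the slab in length exactly [k], while the hypothesis bounds its part in [B] by
    [k]. *)
Lemma le_lebesgue_borel_slab n (k : R) (B : set (E n.+1)) : 0 < k -> measurable B ->
  (forall C : set (E n.+1), C `<=` unit_cube -> is_chain C ->
     (hausdorff1 (B `&` C) <= k%:E)%E) ->
  (lebesgue_borel R n.+1 (B `&` unit_cube) <= lebesgue_borel R n.+1 (middle_slab n.+1 k))%E.
Proof.
move=> k0 mB HB.
rewrite middle_slabE !lebesgue_chain_decomposition//; last exact: measurable_sum_between.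
set S := [set x | _].
have mS : measurable S by exact: measurable_sum_between.
apply: ge0_le_integral => //; [exact: measurable_fun_chain_section..|].
move=> t _; have [l0|l0] := ltP (chain_length t) 0.
  rewrite (_ : chain_section B t = set0) ?measure0//.
  by apply/seteqP; split => // r [/andP[r0 /(le_trans r0)]]; rewrite leNgt l0.
have [lk|kl] := leP (chain_length t) k.
  apply: le_measure; rewrite ?inE; [exact: measurable_chain_section..|].
  move=> r [rl _]; split=> //; rewrite /S /= sum_chain_point//.
  by move: rl => /andP[? ?]; apply/andP; split; lra.
rewrite (_ : chain_section S t = [set` `[(chain_length t - k) / 2, (chain_length t + k) / 2]%R]).
  rewrite lebesgue_measure_itv/= lte_fin ifT; last by lra.
  rewrite -EFinB (_ : _ - _ = k); last by lra.
  apply: le_trans (chain_section_le_hausdorff1 l0 mB) _; apply: HB.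
    by move=> _ [r /= rl <-]; apply: chain_point_unit_cube; rewrite in_itv in rl.
  exact: chain_point_is_chain.
apply/seteqP; split => r; rewrite /chain_section /S /= sum_chain_point// in_itv /=.
  by move=> [_ /andP[? ?]]; apply/andP; split; lra.
by move=> /andP[? ?]; split; apply/andP; split; lra.
Qed.

Lemma lebesgueE n (A : set (E n)) : measurable A -> lebesgue A = lebesgue_borel R n A.
Proof. by move=> mA; rewrite /lebesgue /completed_measure_extension measurable_mu_extE. Qed.

(** Inner approximation by outer approximation of the complement: [B] is what remains of the cube
    [Q] after a Borel cover of [Q] minus [A] whose total measure exceeds the outer measure by less
    than [e]. The Caratheodory condition, tested on [Q], converts this excess into the loss from [A]
    to [B]. *)
Lemma lebesgue_inner_borel n (A : set (E n)) (e : R) :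
  A `<=` unit_cube -> lebesgue_measurable A -> 0 < e ->
  exists B : set (E n), [/\ measurable B, B `<=` A &
    (lebesgue A <= lebesgue_borel R n B + e%:E)%E].
Proof.
move=> Acube mA e0; rewrite /lebesgue /completed_measure_extension.
set nu := lebesgue_borel R n; set out := (nu^*)%mu.
have mQ := @measurable_unit_cube n; set Q := @unit_cube R n in Acube mQ *.
have nuQ : nu Q = 1%E := lebesgue_borel_unit_cube n.
have outQ : (out A + out (Q `\` A) = 1)%E.
  transitivity (out Q).
    by have := mA Q; rewrite setIidr// => H; exact/esym/H.
  by rewrite /out measurable_mu_extE.
have A0 : (0 <= out A)%E by exact: mu_ext_ge0.
have D0 : (0 <= out (Q `\` A))%E by exact: mu_ext_ge0.
have fin : out (Q `\` A) \is a fin_num.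
  by rewrite ge0_fin_numE//; apply: (@le_lt_trans _ _ 1%E); rewrite ?ltry// -outQ leeDr.
have [_ [F [mF DF] <-] Fle] := lb_ereal_inf_adherent e0 fin.
have mUF : measurable (\bigcup_k F k) by exact: bigcupT_measurable.
have mB : measurable (Q `\` \bigcup_k F k) by exact: measurableD.
exists (Q `\` \bigcup_k F k); split => //.
  by move=> x [Qx nF]; apply: contrapT => nA; apply: nF; exact: DF.
rewrite -(leeD2rE _ _ fin) outQ -nuQ.
have QU : Q `<=` (Q `\` \bigcup_k F k) `|` \bigcup_k F k.
  by move=> x Qx; have [|] := pselect ((\bigcup_k F k) x); [right|left].
apply: (@le_trans _ _ (nu ((Q `\` \bigcup_k F k) `|` \bigcup_k F k))).
  by apply: le_measure; rewrite ?inE//; exact: measurableU.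
apply: le_trans (measureU2 _ mB mUF) _.
rewrite -addeA leeD2l//; rewrite addeC; apply: le_trans (ltW Fle).
exact: measure_sigma_subadditive.
Qed.

End borel_comparison.

(** * The Irwin-Hall formula *)

Section irwin_hall.
Context {R : realType}.
Local Notation L := (measurableTypeR R).
Local Notation E n := (euclidean R n).
Local Notation mu := (@lebesgue_measure R).

(** The truncated power. For [n = 0] it is the indicator of [x > 0], which matches the strict
    inequality between sum and [t] in dimension 0. *)
Definition pos_pow n (x : R) : R := if 0 < x then x ^+ n else 0.

Lemma pos_pow_ge0 n x : 0 <= pos_pow n x.
Proof. by rewrite /pos_pow; case: ifPn => // x0; rewrite exprn_ge0// ltW. Qed.

Lemma pos_powE n x : 0 <= x -> pos_pow n.+1 x = x ^+ n.+1.
Proof. by rewrite /pos_pow le_eqVlt => /predU1P[<-|->//]; rewrite ltxx expr0n. Qed.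

Lemma pos_pow_le0 n x : x <= 0 -> pos_pow n x = 0.
Proof. by rewrite /pos_pow leNgt => /negbTE ->. Qed.

Lemma integral_pow n (a b : R) : 0 < b ->
  (\int[mu]_(y in `[0%R, b]) ((a - y) ^+ n)%:E =
   ((a ^+ n.+1 - (a - b) ^+ n.+1) / n.+1%:R)%:E)%E.
Proof.
move=> b0; pose p : {poly R} := a%:P - 'X.
pose P := - (n.+1%:R^-1) *: p ^+ n.+1.
have dp : P^`() = p ^+ n.
  rewrite /P derivZ deriv_exp /p derivB derivC derivX sub0r mulN1r -/p.
  by rewrite mulNrn scalerN scaleNr opprK -[p ^+ n *+ _]scaler_nat scalerA mulVf ?scale1r// pnatr_eq0.
have PE y : P.[y] = - ((a - y) ^+ n.+1 / n.+1%:R).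
  by rewrite /P /p hornerZ horner_exp !hornerE mulNr mulrC.
have pE y : (p ^+ n).[y] = (a - y) ^+ n by rewrite /p horner_exp !hornerE.
under eq_integral do rewrite -pE.
rewrite (@continuous_FTC2 _ _ (horner P)) //.
- by rewrite !PE subr0 -EFinB; congr EFin; ring.
- by apply: continuous_subspaceT; exact: continuous_horner.
- split=> [y _||]; first exact: derivable_horner.
  + by apply: cvg_at_right_filter; exact: continuous_horner.
  + by apply: cvg_at_left_filter; exact: continuous_horner.
- by move=> y _; rewrite -derivE dp.
Qed.

Lemma measurable_pos_pow n a : measurable_fun [set: L] (fun y : L => pos_pow n (a - y)).
Proof.
have m : measurable_fun [set: L] (fun y : L => a - y : R) by exact: measurable_reflection.
apply: measurable_fun_ifT => //; first exact: measurable_fun_ltr.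
exact: measurable_funX.
Qed.

Lemma integral_pos_pow n a :
  (\int[mu]_(y in `[0%R, 1%R]) (pos_pow n (a - y))%:E =
   ((pos_pow n.+1 a - pos_pow n.+1 (a - 1)) / n.+1%:R)%:E)%E.
Proof.
have [a0|a0] := leP a 0.
  rewrite integral0_eq; first by rewrite !pos_pow_le0 ?subrr ?mul0r//; lra.
  by move=> y; rewrite /= in_itv /= => /andP[y0 _]; rewrite pos_pow_le0//; lra.
have ma : measurable_fun [set: L] (fun y : L => (pos_pow n (a - y))%:E).
  by apply/measurable_EFinP; exact: measurable_pos_pow.
have [a1|a1] := leP a 1; last first.
  rewrite pos_powE ?pos_powE; [|lra..]; rewrite -integral_pow//.
  apply: eq_integral => y; rewrite inE /= in_itv /= => /andP[_ y1].
  by rewrite /pos_pow ifT//; lra.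
rewrite (pos_pow_le0 _ (_ : a - 1 <= 0)); last by lra.
rewrite (_ : [set` `[0, 1]] = [set` `[0, a[] `|` [set` `[a, 1]] :> set L); last first.
  apply/seteqP; split => y; rewrite /= !in_itv /=; first by case: (ltP y a); [left|right]; lra.
  by case; lra.
rewrite ge0_integral_setU//; last first.
- by apply/disj_setPS => y [/=]; rewrite !in_itv /=; lra.
- by move=> y _; rewrite lee_fin pos_pow_ge0.
- exact: measurable_funS ma.
rewrite [X in (_ + X)%E]integral0_eq; last first.
  by move=> y; rewrite /= in_itv /= => /andP[ay _]; rewrite pos_pow_le0//; lra.
rewrite adde0 pos_powE; last exact: ltW.
have -> : a ^+ n.+1 - 0 = a ^+ n.+1 - (a - a) ^+ n.+1 by rewrite subrr expr0n.
rewrite -integral_pow// -integral_itv_bndo_bndc; last first.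
  apply/measurable_EFinP; apply: measurable_funX.
  exact: measurable_funS (measurable_reflection a).
apply: eq_integral => y; rewrite inE /= in_itv /= => /andP[_ y1].
by rewrite /pos_pow ifT//; lra.
Qed.

Lemma integrable_pos_pow n a :
  mu.-integrable `[0%R, 1%R] (fun y : L => (pos_pow n (a - y))%:E).
Proof.
apply/integrableP; split.
  by apply/measurable_EFinP; exact: measurable_funS (measurable_pos_pow n a).
under eq_integral do rewrite gee0_abs ?lee_fin ?pos_pow_ge0//.
by rewrite integral_pos_pow ltry.
Qed.

(** Pascal's rule: the alternating difference of order [n] of the first differences is the one of
    order [n + 1] of [g]. *)
Lemma alternating_bin_sumS n (g : nat -> R) :
  \sum_(j < n.+1) (-1) ^+ j * 'C(n, j)%:R * (g j - g j.+1) =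
  \sum_(j < n.+2) (-1) ^+ j * 'C(n.+1, j)%:R * g j.
Proof.
rewrite [RHS]big_ord_recl /= bin0.
under [in RHS]eq_bigr do rewrite /bump leq0n add1n binS natrD mulrDr mulrDl.
rewrite big_split /= addrA.
have -> : (-1) ^+ 0 * 1%:R * g 0 + \sum_(j < n.+1) (-1) ^+ j.+1 * 'C(n, j.+1)%:R * g j.+1 =
    \sum_(j < n.+2) (-1) ^+ j * 'C(n, j)%:R * g j.
  by rewrite [RHS]big_ord_recl /= bin0.
rewrite [X in _ = X + _]big_ord_recr /= bin_small// mulr0 mul0r addr0 -big_split /=.
by apply: eq_bigr => j _; rewrite exprS; ring.
Qed.

(** The probability that [n] independent uniform variables on [[0, 1]] have sum below [t]. *)
Definition irwin_hall n (t : R) : R := n`!%:R^-1 *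
  \sum_(j < n.+1) (-1) ^+ j * 'C(n, j)%:R * pos_pow n (t - j%:R).

(** Adding a variable is convolution with the uniform density. Each truncated power integrates to a
    difference of two at arguments one apart, and [alternating_bin_sumS] collects these. *)
Lemma irwin_hallS n t : (\int[mu]_(y in `[0%R, 1%R]) (irwin_hall n (t - y))%:E =
  (irwin_hall n.+1 t)%:E)%E.
Proof.
rewrite /irwin_hall.
pose c (j : 'I_n.+1) := n`!%:R^-1 * ((-1) ^+ j * 'C(n, j)%:R) : R.
pose f (j : 'I_n.+1) (y : L) := ((c j)%:E * (pos_pow n (t - j%:R - y))%:E)%E.
transitivity (\int[mu]_(y in `[0%R, 1%R]) (\sum_(j < n.+1) f j y))%E.
  apply: eq_integral => y _; rewrite sumEFin mulr_sumr; congr EFin.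
  by apply: eq_bigr => j _; rewrite mulrA; congr (_ * pos_pow _ _); ring.
rewrite integral_sum//; last first.
  by move=> j; apply: integrableZl => //; exact: integrable_pos_pow.
under eq_bigr => j _.
  rewrite integralZl//; last exact: integrable_pos_pow.
  rewrite integral_pos_pow -EFinM.
  over.
rewrite sumEFin; congr EFin.
rewrite -(alternating_bin_sumS n (fun j => pos_pow n.+1 (t - j%:R))) mulr_sumr.
apply: eq_bigr => j _; rewrite factS natrM invfM -[j.+1%:R]natr1 opprD addrA /c.
ring.
Qed.

Lemma measurable_sum_lt n (t : R) : measurable [set x : E n | \sum_(i < n) tnth x i < t].
Proof.
by apply: measurable_set_bool; apply: measurable_fun_ltr => //; exact: measurable_sum_tnth.
Qed.

Lemma measurable_sum_gt n (t : R) : measurable [set x : E n | t < \sum_(i < n) tnth x i].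
Proof.
by apply: measurable_set_bool; apply: measurable_fun_ltr => //; exact: measurable_sum_tnth.
Qed.

Lemma lebesgue_borel_sum_lt n (t : R) :
  lebesgue_borel R n ([set x | \sum_(i < n) tnth x i < t] `&` unit_cube) =
  (irwin_hall n t)%:E.
Proof.
elim: n t => [|n IHn] t.
  rewrite /irwin_hall big_ord1 /= subr0 /pos_pow expr0 fact0 invr1 bin0 !mul1r.
  rewrite diracE; case: ifPn => t0.
    by rewrite mem_set//=; split=> [|[]//]; rewrite big_ord0.
  by rewrite memNset//= big_ord0 => -[h]; rewrite h in t0.
rewrite -irwin_hallS /= /lebesgue_cons /pushforward /product_measure1.
rewrite [RHS]integral_mkcond; apply: eq_integral => y _.
rewrite patchE; case: ifPn => [|]; rewrite ?notin_setE ?inE /= in_itv /= => y01.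
  rewrite -IHn; congr (lebesgue_borel R n _); rewrite xsectionE.
  apply/seteqP; split => x /=.
    by rewrite sum_cons_point => -[h /unit_cube_cons[_ cx]]; split=> //; lra.
  by rewrite sum_cons_point => -[h cx]; split; [lra|exact/unit_cube_cons].
rewrite (_ : xsection _ _ = set0) ?measure0// xsectionE.
by apply/seteqP; split => // x [_ /unit_cube_cons[]].
Qed.

(** Reversing a path, [r] to [chain_length s - r], preserves length and sends level [x] to
    [n + 1 - x], so it exchanges the two sets. *)
Lemma lebesgue_borel_sum_gt n (t : R) :
  lebesgue_borel R n.+1 ([set x | n.+1%:R - t < \sum_(i < n.+1) tnth x i] `&` unit_cube) =
  lebesgue_borel R n.+1 ([set x | \sum_(i < n.+1) tnth x i < t] `&` unit_cube).
Proof.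
rewrite !lebesgue_chain_decomposition; [|exact: measurable_sum_lt|exact: measurable_sum_gt].
apply: eq_integral => s _.
rewrite -[RHS](lebesgue_measure_reflection (chain_length s)); last first.
  by apply: measurable_chain_section; exact: measurable_sum_lt.
congr mu; apply/seteqP; split => r [rl];
  (have l0 : 0 <= chain_length s by lra); rewrite /= sum_chain_point// => h;
  (split; [lra|rewrite /= sum_chain_point//; lra]).
Qed.

End irwin_hall.

(** * The volume of the slab and the theorem *)

Lemma slab_volumeE (R : realType) (n : nat) (k : R) : 0 < k <= n.+1%:R ->
  slab_volume n.+1 k = 1 - 2 * irwin_hall n.+1 ((n.+1%:R - k) / 2).
Proof.
move=> /andP[k0 kn]; rewrite /slab_volume /irwin_hall; set t := (_ - k) / 2.
have t0 : 0 <= t by rewrite /t; lra.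
have tn : t < n.+1%:R by rewrite /t; lra.
have /andP[tl tr] := truncn_itv t0; set m := Num.truncn t in tl tr *.
have mn : (m.+1 <= n.+2)%N by rewrite ltnS ltnW// -(ltr_nat R); exact: le_lt_trans tn.
rewrite [in RHS]mulrA; congr (1 - _ * _).
rewrite -[RHS](big_mkord xpredT (fun j => (-1) ^+ j * 'C(n.+1, j)%:R * pos_pow n.+1 (t - j%:R))).
(* The truncated powers vanish for [j > m], which cuts the sum at the floor of [t]; for [j <= m]
   they are ordinary powers. *)
rewrite [RHS](big_cat_nat (n := m.+1))//= [X in _ = _ + X]big1_seq ?addr0; last first.
  move=> j; rewrite mem_index_iota => /andP[_ /andP[mj _]].
  rewrite pos_pow_le0 ?mulr0// subr_le0; apply: le_trans (ltW tr) _.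
  by rewrite ler_nat.
apply: eq_big_nat => j /andP[_ jm]; rewrite pos_powE// subr_ge0.
by apply: le_trans tl; rewrite ler_nat.
Qed.

(** The slab, [lo] and [hi] partition the cube, since [n + 1 - t = (n + 1 + k) / 2]; the two outer
    parts have equal measure by symmetry. *)
Lemma lebesgue_borel_middle_slab (R : realType) (n : nat) (k : R) : 0 < k <= n.+1%:R ->
  lebesgue_borel R n.+1 (middle_slab n.+1 k) = (slab_volume n.+1 k)%:E.
Proof.
move=> k0n; rewrite slab_volumeE//; set t := (_ - k) / 2.
have /andP[k0 _] := k0n.
set nu := lebesgue_borel R n.+1; set Q := @unit_cube R n.+1.
pose lo := [set x : euclidean R n.+1 | \sum_(i < n.+1) tnth x i < t] `&` Q.
pose hi := [set x : euclidean R n.+1 | n.+1%:R - t < \sum_(i < n.+1) tnth x i] `&` Q.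
have mQ : measurable Q by exact: measurable_unit_cube.
have mlo : measurable lo by apply: measurableI => //; exact: measurable_sum_lt.
have mhi : measurable hi by apply: measurableI => //; exact: measurable_sum_gt.
have mslab := @measurable_middle_slab R n.+1 k.
have nulo : nu lo = (irwin_hall n.+1 t)%:E by exact: lebesgue_borel_sum_lt.
have nuhi : nu hi = (irwin_hall n.+1 t)%:E by rewrite /nu lebesgue_borel_sum_gt.
have nu_lohi : nu (lo `|` hi) = (nu lo + nu hi)%E.
  apply: measureU => //; apply/seteqP; split => // x [[/= h1 _] [/= h2 _]].
  by move: h1 h2; rewrite /t; lra.
have nu_cube : nu (middle_slab n.+1 k `|` (lo `|` hi)) =
    (nu (middle_slab n.+1 k) + nu (lo `|` hi))%E.
  apply: measureU => //; first exact: measurableU.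
  apply/seteqP; split => // x [[_ /andP[h1 h2]] [[/= h _]|[/= h _]]].
    by move: h; rewrite ltNge h1.
  by move: h; rewrite ltNge (le_trans h2)// /t; lra.
have Q_split : middle_slab n.+1 k `|` (lo `|` hi) = Q.
  apply/seteqP; split => x; first by case=> [[]|[[]|[]]].
  move=> Qx; have [h1|h1] := ltP (\sum_(i < n.+1) tnth x i) t; first by right; left.
  have [h2|h2] := ltP (n.+1%:R - t) (\sum_(i < n.+1) tnth x i); first by right; right.
  by left; split=> //; rewrite -/t h1 /= (le_trans h2)// /t; lra.
have nuQ : nu Q = 1%E := @lebesgue_borel_unit_cube R n.+1.
move: nu_cube; rewrite Q_split nuQ nu_lohi nulo nuhi -EFinD => /eqP.
rewrite -sube_eq ?fin_num_adde_defl// => /eqP <-.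
by rewrite -EFinB; congr EFin; ring.
Qed.

Theorem theorem1p5 (R : realType) (n : nat) (kappa : R) :
  (0 < n)%N -> 0 < kappa <= n%:R ->
  [/\ (forall A : set (euclidean R n),
         A `<=` unit_cube ->
         lebesgue_measurable A ->
         (forall C : set (euclidean R n), C `<=` unit_cube -> is_chain C ->
            (hausdorff1 (A `&` C) <= kappa%:E)%E) ->
         (lebesgue A <= lebesgue (middle_slab n kappa))%E),
      (forall C : set (euclidean R n), C `<=` unit_cube -> is_chain C ->
         (hausdorff1 (middle_slab n kappa `&` C) <= kappa%:E)%E) &
      lebesgue (middle_slab n kappa) = (slab_volume n kappa)%:E].
Proof.
case: n => [//|n] _ kn; have /andP[k0 _] := kn; split.
- move=> A Acube mA HA; rewrite (lebesgueE (@measurable_middle_slab R n.+1 kappa)).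
  apply/lee_addgt0Pr => e e0.
  (* The chain condition passes to subsets, so a Borel [B] inside [A] may replace [A] up to [e]. *)
  have [B [mB BA AB]] := lebesgue_inner_borel Acube mA e0.
  apply: le_trans AB _; apply: leeD2r.
  rewrite -(setIidl (subset_trans BA Acube)).
  apply: le_lebesgue_borel_slab => // C Ccube chC.
  by apply: le_trans (HA C Ccube chC); apply: le_hausdorff1; exact: setSI.
- by move=> C _; exact: hausdorff1_chain_slab.
- by rewrite (lebesgueE (@measurable_middle_slab R n.+1 kappa)) lebesgue_borel_middle_slab.
Qed.
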